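(* On the 3-dimensional Heisenberg Lie algebra $\mathfrak n_3$, up to equivalence (scaling and isomorphism), there is a unique non-classical generalized nilsoliton. It is given, in an orthonormal basis $\{e_1,e_2,e_3\}$, by $$\mu(e_1,e_2)=e_3,\quad H=e^{123},\quad\lambda=-2,\quad D=\operatorname{diag}(1,1,2).$$
   Context: A triple $(\mu,g,H)$ consists of a nilpotent Lie bracket $\mu$ on a finite-dimensional real vector space $\mathfrak g$, an inner product $g$ on $\mathfrak g$, and a 3-form $H\in\Lambda^3\mathfrak g^*$ closed for the Chevalley–Eilenberg differential $\mathrm d_\mu$. It is a generalized nilsoliton if there exist $\lambda\in\mathbb R$ and a derivation $D\in\operatorname{Der}(\mathfrak g,\mu)$ with $$\operatorname{Ric}^B_{\mu,H}=\lambda\operatorname{Id}+D,\qquad\Delta_\mu H=\lambda H+\rho(\operatorname{Ric}^B_{\mu,H})H .$$ Here $\operatorname{Ric}^B_{\mu,H}=\operatorname{Ric}_\mu-\frac14g^{-1}H^2\in\operatorname{End}(\mathfrak g)$, $\operatorname{Ric}_\mu$ is the Ricci endomorphism of the left-invariant metric $g$ on the simply connected Lie group of $(\mathfrak g,\mu)$, $H^2(X,Y)=\sum_{i,j}H(X,e_i,e_j)H(Y,e_i,e_j)$ in an orthonormal basis, $\Delta_\mu H=-\mathrm d_\mu\mathrm d_\mu^*H$ with $\mathrm d^*_\mu$ the usual codifferential, and $(\rho(A)H)(X,Y,Z)=-H(AX,Y,Z)-H(X,AY,Z)-H(X,Y,AZ)$. It is non-classical if $H\neq0$. Two triples are equivalent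 if there are a Lie algebra isomorphism $\varphi:(\mathfrak g,\mu)\to(\mathfrak g',\mu')$, $c>0$ and $\epsilon\in\{1,-1\}$ with $\varphi^*g'=c\,g$ and $\varphi^*H'=\epsilon c\,H$ (this corresponds to isometries between the associated metric exact Courant algebroids, up to scaling by the nonzero constant $\epsilon c$). The constants $\lambda,D$ are given for the listed representative. $e^{ijk}=e^i\wedge e^j\wedge e^k$. *)

(* Defs.v *)
From HB Require Import structures.
From mathcomp Require Import all_boot all_order all_algebra.
From mathcomp Require Import reals ring lra.

Set Implicit Arguments.
Unset Strict Implicit.
Unset Printing Implicit Defensive.

Import Order.TTheory GRing.Theory Num.Theory.
Local Open Scope ring_scope.

Section Triples.
Context {R : realType} {V : vectType R}.
Implicit Types (mu : V -> V -> V) (g : V -> V -> R) (H : V -> V -> V -> R).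

Definition lie_bracket mu : Prop :=
  [/\ forall y, linear (fun x => mu x y),
      forall x, linear (fun y => mu x y),
      forall x, mu x x = 0
    & forall x y z, mu x (mu y z) + mu y (mu z x) + mu z (mu x y) = 0].

(* Lower central series; brackets of basis vectors span [V, lcs k] because
   mu is bilinear. *)
Fixpoint lcs mu (k : nat) : {vspace V} :=
  if k is k'.+1 then
    <<[seq mu x y | x <- vbasis {:V}, y <- vbasis (lcs mu k')]>>%VS
  else {:V}%VS.

Definition nilpotent_bracket mu : Prop := exists k, lcs mu k = 0%VS.

Definition inner_product g : Prop :=
  [/\ forall y, scalar (fun x => g x y),
      forall x y, g x y = g y x
    & forall x, x != 0 -> 0 < g x x].

Definition two_form (a : V -> V -> R) : Prop :=
  [/\ forall y, scalar (fun x => a x y),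
      forall x, scalar (fun y => a x y)
    & forall x, a x x = 0].

Definition three_form H : Prop :=
  [/\ forall y z, scalar (fun x => H x y z),
      forall x z, scalar (fun y => H x y z),
      forall x y, scalar (fun z => H x y z)
    & [/\ forall x y, H x x y = 0,
          forall x y, H x y x = 0
        & forall x y, H y x x = 0]].

(* Chevalley-Eilenberg differential on 2-forms and on 3-forms:
   (d a)(x_0, .., x_k)
     = \sum_(i < j) (-1)^(i+j) a(mu x_i x_j, x_0, .., ^x_i, .., ^x_j, .., x_k) *)
Definition d2 mu (a : V -> V -> R) : V -> V -> V -> R := fun x y z =>
  - a (mu x y) z + a (mu x z) y - a (mu y z) x.

Definition d3 mu H : V -> V -> V -> V -> R := fun x y z w =>
  - H (mu x y) z w + H (mu x z) y w - H (mu x w) y z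
  - H (mu y z) x w + H (mu y w) x z - H (mu z w) x y.

Definition closed mu H : Prop := forall x y z w, d3 mu H x y z w = 0.

Definition is_triple mu g H : Prop :=
  [/\ lie_bracket mu, nilpotent_bracket mu, inner_product g,
      three_form H & closed mu H].

Definition orthonormal_basis g (e : seq V) : Prop :=
  basis_of {:V} e /\ {in e &, forall u v, g u v = (u == v)%:R}.

(* In what follows e is meant to be an orthonormal basis for g. *)

(* Levi-Civita connection of the left-invariant metric g, evaluated on
   left-invariant vector fields: this is Koszul's formula, in which all the
   derivatives of (constant) inner products vanish. *)
Definition nabla mu g (e : seq V) (x y : V) : V :=
  \sum_(u <- e)
    (2^-1 * (g (mu x y) u - g (mu y u) x + g (mu u x) y)) *: u.

Definition curvature mu g e (x y z : V) : V :=
  nabla mu g e x (nabla mu g e y z) - nabla mu g e y (nabla mu g e x z)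
  - nabla mu g e (mu x y) z.

Definition ricci_form mu g e (y z : V) : R :=
  \sum_(u <- e) g (curvature mu g e u y z) u.

(* The endomorphism g^-1 b of a bilinear form b. *)
Definition sharp (e : seq V) (b : V -> V -> R) (x : V) : V :=
  \sum_(u <- e) b x u *: u.

Definition ricci mu g e : V -> V := sharp e (ricci_form mu g e).

Definition square_form (e : seq V) H (x y : V) : R :=
  \sum_(u <- e) \sum_(v <- e) H x u v * H y u v.

Definition ricciB mu g e H (x : V) : V :=
  ricci mu g e x - 4^-1 *: sharp e (square_form e H) x.

(* Inner products induced on 2-forms and 3-forms: the e^{ij} with i < j, resp.
   the e^{ijk} with i < j < k, are orthonormal. *)
Definition form_dot2 (e : seq V) (a b : V -> V -> R) : R :=
  2^-1 * \sum_(u <- e) \sum_(v <- e) a u v * b u v.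

Definition form_dot3 (e : seq V) (H K : V -> V -> V -> R) : R :=
  6^-1 * \sum_(u <- e) \sum_(v <- e) \sum_(w <- e) H u v w * K u v w.

Definition flat_wedge g (x y : V) : V -> V -> R := fun u v =>
  g x u * g y v - g x v * g y u.

(* The codifferential on 3-forms, i.e. the adjoint of d2 (see
   codifferential_adjoint): its value at (x, y) is its inner product with the
   2-form x^flat /\ y^flat. *)
Definition codifferential mu g e H : V -> V -> R := fun x y =>
  form_dot3 e (d2 mu (flat_wedge g x y)) H.

Definition laplacian mu g e H : V -> V -> V -> R := fun x y z =>
  - d2 mu (codifferential mu g e H) x y z.

Definition rho (A : V -> V) H : V -> V -> V -> R := fun x y z =>
  - H (A x) y z - H x (A y) z - H x y (A z).

Definition derivation mu (D : 'End(V)) : Prop :=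
  forall x y, D (mu x y) = mu (D x) y + mu x (D y).

Definition nilsoliton_with mu g H (e : seq V) (lambda : R) (D : 'End(V)) :
    Prop :=
  [/\ is_triple mu g H,
      orthonormal_basis g e,
      derivation mu D,
      forall x, ricciB mu g e H x = lambda *: x + D x
    & forall x y z, laplacian mu g e H x y z
        = lambda * H x y z + rho (ricciB mu g e H) H x y z].

(* ricciB and laplacian do not depend on the choice of the orthonormal
   basis e, which always exists. *)
Definition generalized_nilsoliton mu g H : Prop :=
  exists e lambda D, nilsoliton_with mu g H e lambda D.

Definition non_classical H : Prop := exists x y z, H x y z != 0.

Lemma onb_expand g e x : inner_product g -> orthonormal_basis g e ->
  x = \sum_(u <- e) g x u *: u.
Proof.
move=> [gl gs _] [be he].
have ue : uniq e by apply: free_uniq (basis_free be).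
have : x \in <<in_tuple e>>%VS by rewrite (span_basis be) memvf.
move=> /coord_span xE.
rewrite (big_tnth _ _ e) {1}xE.
pose gx v : {scalar V} := HB.pack (fun x => g x v)
  (GRing.isLinear.Build R V R *%R (fun x => g x v) (gl v)).
have gZ a u v : g (a *: u) v = a * g u v.
  by rewrite -[LHS]/(gx v _) linearZ.
apply: eq_bigr => i _; rewrite (tnth_nth 0) /=; congr (_ *: _).
symmetry; rewrite -[LHS]/(gx e`_i x) {1}xE linear_sum /= (bigD1 i) //= big1.
  by rewrite addr0 gZ he ?mem_nth // eqxx mulr1.
move=> j ji; rewrite gZ he ?mem_nth // nth_uniq //.
by rewrite val_eqE (negPf ji) mulr0.
Qed.

Lemma nablaE mu g e x y z : lie_bracket mu -> inner_product g ->
  orthonormal_basis g e ->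
  g (nabla mu g e x y) z
  = 2^-1 * (g (mu x y) z - g (mu y z) x + g (mu z x) y).
Proof.
move=> [ml mr _ _] ig oe; have [gl gs _] := ig.
have gr v : scalar (g v) by move=> a u w; rewrite gs gl ![g _ v]gs.
pose F z := 2^-1 * (g (mu x y) z - g (mu y z) x + g (mu z x) y).
have FL : scalar F.
  by move=> a u v; rewrite /F gr (mr y) (ml x) !gl /=; ring.
pose Fs : {scalar V} := HB.pack F (GRing.isLinear.Build R V R *%R F FL).
pose G : {scalar V} := HB.pack (fun x => g x z)
  (GRing.isLinear.Build R V R *%R (fun x => g x z) (gl z)).
rewrite -/(F z) -[F z]/(Fs z) [in RHS](onb_expand z ig oe) linear_sum /=.
rewrite -[LHS]/(G (nabla mu g e x y)) linear_sum; apply: eq_bigr => u _.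
by rewrite linearZ -[RHS]/(Fs _) linearZ /= [g u z]gs mulrC.
Qed.

Lemma lie_bracketC mu x y : lie_bracket mu -> mu y x = - mu x y.
Proof.
move=> [ml mr m0 _]; apply/eqP; rewrite -addr_eq0 -(m0 (x + y)).
have addl u v w : mu (u + v) w = mu u w + mu v w.
  by have := ml w 1 u v; rewrite /= !scale1r.
have addr u v w : mu w (u + v) = mu w u + mu w v.
  by have := mr w 1 u v; rewrite /= !scale1r.
by rewrite addl !addr !m0 add0r addr0 addrC.
Qed.

Lemma nabla_metric mu g e x y z : lie_bracket mu -> inner_product g ->
  orthonormal_basis g e ->
  g (nabla mu g e x y) z + g y (nabla mu g e x z) = 0.
Proof.
move=> lm ig oe; have [gl gs _] := ig.
have gN u v : g (- u) v = - g u v.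
  have := gl v (-1) u 0; rewrite /= addr0 scaleN1r => ->.
  by have := gl v (-1) 0 0; rewrite /= addr0 scaler0 => ?; lra.
rewrite [g y _]gs !nablaE // (lie_bracketC y z lm) (lie_bracketC x z lm).
by rewrite (lie_bracketC x y lm) !gN; ring.
Qed.

Lemma nabla_torsion_free mu g e x y : lie_bracket mu -> inner_product g ->
  orthonormal_basis g e ->
  nabla mu g e x y - nabla mu g e y x = mu x y.
Proof.
move=> lm ig oe; have [gl gs _] := ig.
have gN u v : g (- u) v = - g u v.
  have := gl v (-1) u 0; rewrite /= addr0 scaleN1r => ->.
  by have := gl v (-1) 0 0; rewrite /= addr0 scaler0 => ?; lra.
rewrite [RHS](onb_expand _ ig oe) -sumrB; apply: eq_bigr => u _.
rewrite -scalerBl; congr (_ *: _).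
rewrite (lie_bracketC x y lm) (lie_bracketC y u lm) (lie_bracketC x u lm) !gN.
by field.
Qed.

Lemma two_form_expand g e a x y : inner_product g -> orthonormal_basis g e ->
  two_form a ->
  a x y = 2^-1 * \sum_(u <- e) \sum_(v <- e) a u v * flat_wedge g u v x y.
Proof.
move=> ig oe [al ar a0]; have [gl gs _] := ig.
have adl u v w : a (u + v) w = a u w + a v w.
  by have := al w 1 u v; rewrite /= scale1r mul1r.
have adr u v w : a w (u + v) = a w u + a w v.
  by have := ar w 1 u v; rewrite /= scale1r mul1r.
have aC u v : a v u = - a u v.
  by have := a0 (u + v); rewrite adl !adr !a0; lra.
pose A1 w : {scalar V} := HB.pack (fun x => a x w)
  (GRing.isLinear.Build R V R *%R (fun x => a x w) (al w)).
pose A2 w : {scalar V} := HB.pack (a w)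
  (GRing.isLinear.Build R V R *%R (a w) (ar w)).
have A1Z w c u : a (c *: u) w = c * a u w.
  by rewrite -[LHS]/(A1 w _) linearZ.
have A2Z w c u : a w (c *: u) = c * a w u.
  by rewrite -[LHS]/(A2 w _) linearZ.
have E : a x y = \sum_(u <- e) \sum_(v <- e) a u v * (g u x * g v y).
  rewrite -[LHS]/(A1 y x) [in LHS](onb_expand x ig oe) linear_sum /=.
  apply: eq_bigr => u _; rewrite A1Z -[a u y]/(A2 u y).
  rewrite [in LHS](onb_expand y ig oe) linear_sum mulr_sumr.
  by apply: eq_bigr => v _; rewrite /= A2Z [g x u]gs [g y v]gs; ring.
have E' : a x y = - \sum_(u <- e) \sum_(v <- e) a u v * (g u y * g v x).
  rewrite E exchange_big -sumrN; apply: eq_bigr => u _.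
  by rewrite -sumrN; apply: eq_bigr => v _; rewrite (aC u v); ring.
have -> : \sum_(u <- e) \sum_(v <- e) a u v * flat_wedge g u v x y
    = a x y + a x y.
  rewrite {1}E E' -sumrB; apply: eq_bigr => u _.
  by rewrite -sumrB; apply: eq_bigr => v _; rewrite /flat_wedge; ring.
by field.
Qed.

Lemma form_dot3_suml I (s : seq I) (c : I -> R) e F H :
  form_dot3 e (fun x y z => \sum_(i <- s) c i * F i x y z) H
  = \sum_(i <- s) c i * form_dot3 e (F i) H.
Proof.
rewrite /form_dot3; elim: s => [|i s IHs].
  rewrite big_nil big1 ?mulr0 // => u _.
  by rewrite big1 // => v _; rewrite big1 // => w _; rewrite big_nil mul0r.
rewrite big_cons -IHs mulrCA -mulrDr; congr (_ * _).
rewrite mulr_sumr -big_split; apply: eq_bigr => u _ /=.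
rewrite mulr_sumr -big_split; apply: eq_bigr => v _ /=.
rewrite mulr_sumr -big_split; apply: eq_bigr => w _ /=.
by rewrite big_cons mulrDl mulrA.
Qed.

Lemma codifferential_adjoint mu g e a H : inner_product g ->
  orthonormal_basis g e -> two_form a ->
  form_dot3 e (d2 mu a) H = form_dot2 e a (codifferential mu g e H).
Proof.
move=> ig oe fa.
have E x y z : d2 mu a x y z = \sum_(u <- e) 2^-1 * \sum_(v <- e)
    a u v * d2 mu (flat_wedge g u v) x y z.
  rewrite /d2 !(two_form_expand _ _ ig oe fa) -!mulrN -!mulrDr -mulr_sumr.
  congr (_ * _).
  rewrite -!sumrN -!big_split; apply: eq_bigr => u _ /=.
  by rewrite -!sumrN -!big_split; apply: eq_bigr => v _ /=; ring.
transitivity (form_dot3 e (fun x y z => \sum_(u <- e) 2^-1 * \sum_(v <- e)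
    a u v * d2 mu (flat_wedge g u v) x y z) H).
  by congr (_ * _); do 3![apply: eq_bigr => ? _]; rewrite E.
rewrite (form_dot3_suml _ (fun=> 2^-1)) /form_dot2 mulr_sumr.
by apply: eq_bigr => u _; rewrite form_dot3_suml.
Qed.

End Triples.

Definition lie_iso (R : realType) (V V' : vectType R)
    (mu : V -> V -> V) (mu' : V' -> V' -> V') (phi : 'Hom(V, V')) : Prop :=
  bijective phi /\ forall x y, phi (mu x y) = mu' (phi x) (phi y).

Definition lie_isomorphic (R : realType) (V V' : vectType R)
    (mu : V -> V -> V) (mu' : V' -> V' -> V') : Prop :=
  exists phi : 'Hom(V, V'), lie_iso mu mu' phi.

Definition equivalent_triples (R : realType) (V V' : vectType R)
    (mu : V -> V -> V) (g : V -> V -> R) (H : V -> V -> V -> R)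
    (mu' : V' -> V' -> V') (g' : V' -> V' -> R) (H' : V' -> V' -> V' -> R) :
    Prop :=
  exists (phi : 'Hom(V, V')) (c eps : R),
    [/\ lie_iso mu mu' phi, 0 < c, eps = 1 \/ eps = -1,
        forall x y, g' (phi x) (phi y) = c * g x y
      & forall x y z, H' (phi x) (phi y) (phi z) = eps * c * H x y z].

Section Heisenberg.
Context (R : realType).
Implicit Types x y z : 'rV[R]_3.

(* The k-th basis vector, counting from 0. *)
Definition heis_basis (k : 'I_3) : 'rV[R]_3 := delta_mx 0 k.

Definition heis_bracket x y : 'rV[R]_3 :=
  (x 0 0 * y 0 1 - x 0 1 * y 0 0) *: heis_basis 2.

Definition heis_metric x y : R := \sum_(k < 3) x 0 k * y 0 k.

(* e^{123}, with the convention e^{123}(e_1, e_2, e_3) = 1. *)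
Definition heis_form x y z : R := \det (\matrix_(i < 3) nth 0 [:: x; y; z] i).

Definition heis_derivation : 'End('rV[R]_3) :=
  linfun (mulmxr (diag_mx (\row_(k < 3) nth 0 [:: 1; 1; 2] k))).

End Heisenberg.

(* Main.v *)
From HB Require Import structures.
Require Import Defs.
From mathcomp Require Import all_boot all_order all_algebra.
From mathcomp Require Import reals ring lra.

(* Choose an orthonormal basis f1, f2, f3 with f3 spanning the centre, so that
   mu(f1, f2) = a f3 with a <> 0 and H = h f^{123}. Then Ric^B is diagonal with
   eigenvalues k1 = k2 = -(a^2 + h^2)/2 and k3 = (a^2 - h^2)/2, and the
   Laplacian of H vanishes. The derivation equation gives lambda = 2 k1 - k3;
   the equation for H gives lambda = 2 k1 + k3 if h <> 0. Hence k3 = 0, that is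
   a = h or a = - h, and x |-> a (x1, x2, x3) is an equivalence with the model,
   with c = a^2 and epsilon = h / a. The model itself is the case a = h = 1. *)

Set Implicit Arguments.
Unset Strict Implicit.
Unset Printing Implicit Defensive.

Import Order.TTheory GRing.Theory Num.Theory.
Local Open Scope ring_scope.

(** * Bundled maps from linearity predicates *)

Section LinearMaps.
Context {R : realType} {V W : vectType R}.

Lemma linear_fun (f : V -> W) : linear f -> exists F : {linear V -> W}, F =1 f.
Proof.
move=> fl; pose F : {linear V -> W} :=
  HB.pack f (GRing.isLinear.Build R V W *:%R f fl).
by exists F.
Qed.

Lemma scalar_fun (f : V -> R) : scalar f -> exists F : {scalar V}, F =1 f.
Proof.
move=> fl; pose F : {scalar V} :=
  HB.pack f (GRing.isLinear.Build R V R *%R f fl).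
by exists F.
Qed.

End LinearMaps.

(** * Orthonormal families, traces and Gram-Schmidt *)

Section InnerProducts.
Context {R : realType} {V : vectType R} (g : V -> V -> R).
Hypothesis ig : inner_product g.

Lemma inner_sym x y : g x y = g y x.
Proof. by case: ig. Qed.

Lemma innerZl a x z : g (a *: x) z = a * g x z.
Proof. by have [/(_ z)/scalar_fun[F FE] _ _] := ig; rewrite -!FE linearZ. Qed.

Lemma innerDl x y z : g (x + y) z = g x z + g y z.
Proof. by have [/(_ z)/scalar_fun[F FE] _ _] := ig; rewrite -!FE raddfD. Qed.

Lemma innerNl x z : g (- x) z = - g x z.
Proof. by rewrite -scaleN1r innerZl mulN1r. Qed.

Lemma innerBl x y z : g (x - y) z = g x z - g y z.
Proof. by have [/(_ z)/scalar_fun[F FE] _ _] := ig; rewrite -!FE raddfB. Qed.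

Lemma inner0l z : g 0 z = 0.
Proof. by rewrite -[0](scale0r 0) innerZl mul0r. Qed.

Lemma inner_suml I (s : seq I) (F : I -> V) z :
  g (\sum_(i <- s) F i) z = \sum_(i <- s) g (F i) z.
Proof.
have [/(_ z)/scalar_fun[G GE] _ _] := ig; rewrite -GE raddf_sum.
by apply: eq_bigr => i _; apply: GE.
Qed.

Lemma innerZr a x z : g z (a *: x) = a * g z x.
Proof. by rewrite inner_sym innerZl inner_sym. Qed.

Lemma onb_parseval e x y : orthonormal_basis g e ->
  g x y = \sum_(u <- e) g x u * g y u.
Proof.
move=> oe; rewrite {1}(onb_expand x ig oe) inner_suml.
by apply: eq_bigr => u _; rewrite innerZl [g u y]inner_sym.
Qed.

Lemma onb_scalar e (b : V -> R) x : orthonormal_basis g e -> scalar b ->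
  b x = \sum_(u <- e) g x u * b u.
Proof.
move=> oe /scalar_fun[B BE]; rewrite -BE {1}(onb_expand x ig oe) linear_sum.
by apply: eq_bigr => u _; rewrite linearZ /= BE.
Qed.

(** Basis independence of the trace of [b] relative to [g]: one slot is expanded along [f], the sums
    are exchanged, and the sum over [e] is reassembled in the other slot. *)
Lemma onb_trace e f (b : V -> V -> R) :
  orthonormal_basis g e -> orthonormal_basis g f ->
  (forall y, scalar (fun x => b x y)) -> (forall x, scalar (b x)) ->
  \sum_(u <- e) b u u = \sum_(v <- f) b v v.
Proof.
move=> oe oF bl br.
have E u v : b u v = \sum_(w <- f) g u w * b w v.
  exact: (@onb_scalar f (fun x => b x v) _ oF).
under eq_bigr do rewrite E.
rewrite exchange_big; apply: eq_bigr => w _ /=.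
by rewrite (onb_scalar w oe (br w)); apply: eq_bigr => u _; rewrite inner_sym.
Qed.

(** The Gram condition sees membership only and would tolerate repetitions, hence [uniq]. Spanning
    is left out so that partial families qualify. *)
Definition orthonormal (s : seq V) : Prop :=
  uniq s /\ {in s &, forall u v, g u v = (u == v)%:R}.

Lemma orthonormal_free s : orthonormal s -> free s.
Proof.
move=> [us os]; apply/(@freeP _ _ _ (in_tuple s)) => k sk i.
have := inner0l s`_i; rewrite -{1}sk inner_suml (bigD1 i) //= big1 => [|j ji].
  by rewrite addr0 innerZl os ?mem_nth // eqxx mulr1.
rewrite innerZl os ?mem_nth // nth_uniq //.
by rewrite val_eqE (negPf ji) mulr0.
Qed.

Lemma orthonormal_basisP s : orthonormal s -> size s = dim V ->
  orthonormal_basis g s.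
Proof.
move=> os zs; split; last by case: os.
by rewrite basisEfree orthonormal_free // subvf dimvf zs /=.
Qed.

Lemma orthonormal_cons s v : orthonormal s -> v != 0 ->
  {in s, forall u, g v u = 0} ->
  orthonormal ((Num.sqrt (g v v))^-1 *: v :: s).
Proof.
move=> [us os] v0 vs; have [_ _ /(_ v v0) vp] := ig.
set r := Num.sqrt _; have r0 : r != 0 by rewrite sqrtr_eq0 -ltNge.
have rr : r * r = g v v by rewrite -expr2 sqr_sqrtr ?ltW.
have ns : r^-1 *: v \notin s.
  apply/negP => vins; have := os _ _ vins vins.
  rewrite eqxx innerZl vs // mulr0 => /eqP.
  by rewrite eq_sym oner_eq0.
split=> [|x y]; first by rewrite /= ns.
rewrite !inE => /orP[/eqP->|xs] /orP[/eqP->|ys]; last exact: os.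
- by rewrite eqxx innerZl innerZr -rr mulKf // mulVf.
- rewrite innerZl vs // mulr0; case: eqP => // E.
  by rewrite -E (negPf ns) in ys.
rewrite innerZr inner_sym vs // mulr0; case: eqP => // E.
by rewrite E (negPf ns) in xs.
Qed.

(** Gram-Schmidt step: a vector outside the span of [s], minus its projection to that span, is
    nonzero and orthogonal to [s]. *)
Lemma orthonormal_extend s : orthonormal s -> (size s < dim V)%N ->
  exists w, orthonormal (w :: s).
Proof.
move=> os zs; have [us gs] := os.
have /subvPn[v _ vs] : ~~ ({:V} <= <<s>>)%VS.
  apply: contraL zs => /dimvS; rewrite dimvf -leqNgt => /leq_trans; apply.
  exact: dim_span.
pose w := v - \sum_(u <- s) g v u *: u.
have ws : {in s, forall u, g w u = 0}.
  move=> u uins; rewrite innerBl inner_suml (bigD1_seq u) //=.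
  rewrite big1_seq => [|t /andP[tu tins]].
    by rewrite innerZl (gs u) // eqxx mulr1 addr0 subrr.
  by rewrite innerZl (gs t) // (negPf tu) mulr0.
exists ((Num.sqrt (g w w))^-1 *: w); apply: orthonormal_cons => //.
apply: contra vs; rewrite subr_eq0 => /eqP->.
by rewrite big_seq; apply: memv_suml => u uins; rewrite memvZ // memv_span.
Qed.

(** New vectors are prepended, so the normalized [v] stays last, in the place meant for the central
    direction. *)
Lemma onb_adapted v : v != 0 -> dim V = 3 ->
  exists f1 f2, orthonormal_basis g [:: f1; f2; (Num.sqrt (g v v))^-1 *: v].
Proof.
move=> v0 dV.
have o0 : orthonormal [::] by split.
have o1 := orthonormal_cons o0 v0 (fun u h => False_ind _ (notF h)).
have [|f2 o2] := orthonormal_extend o1; first by rewrite dV.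
have [|f1 o3] := orthonormal_extend o2; first by rewrite dV.
by exists f1, f2; apply: orthonormal_basisP; rewrite ?dV.
Qed.

End InnerProducts.

(** * Curvature and 3-form computations in an adapted basis *)

(* The tensors are computed from an arbitrary orthonormal basis e, as in the
   definition of a generalized nilsoliton, but expressed in coordinates with
   respect to the adapted basis; [onb_trace] converts the sums over e. *)
Section AdaptedBasis.
Context {R : realType} {V : vectType R}.
Variables (mu : V -> V -> V) (g : V -> V -> R) (H : V -> V -> V -> R).
Variables (e : seq V) (f1 f2 f3 : V) (a h : R).
Hypotheses (lm : lie_bracket mu) (ig : inner_product g) (fH : three_form H).
Hypotheses (oe : orthonormal_basis g e).
Hypotheses (of3 : orthonormal_basis g [:: f1; f2; f3]).
Hypotheses (mu12 : mu f1 f2 = a *: f3).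
Hypotheses (mu13 : mu f1 f3 = 0) (mu23 : mu f2 f3 = 0).
Hypothesis Hh : H f1 f2 f3 = h.

Let coordE x : x = g x f1 *: f1 + g x f2 *: f2 + g x f3 *: f3.
Proof. by rewrite {1}(onb_expand x ig of3) !big_cons big_nil addr0 addrA. Qed.

Let innerE x y : g x y = g x f1 * g y f1 + g x f2 * g y f2 + g x f3 * g y f3.
Proof. by rewrite (onb_parseval ig x y of3) !big_cons big_nil addr0 addrA. Qed.

Lemma adapted_gram :
  (g f1 f1 = 1) * (g f1 f2 = 0) * (g f1 f3 = 0) * (g f2 f1 = 0) *
  (g f2 f2 = 1) * (g f2 f3 = 0) * (g f3 f1 = 0) * (g f3 f2 = 0) *
  (g f3 f3 = 1).
Proof.
have [bf onf] := of3.
have := free_uniq (basis_free bf); rewrite /= !inE !negb_or andbT.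
case/andP=> /andP[f12 f13] f23.
do !split; rewrite onf ?inE ?eqxx ?orbT //.
all: by rewrite ?[f2 == f1]eq_sym ?[f3 == _]eq_sym ?(negPf f12) ?(negPf f13)
  ?(negPf f23).
Qed.

Lemma adapted_bracket x y :
  mu x y = (a * (g x f1 * g y f2 - g x f2 * g y f1)) *: f3.
Proof.
have [ml mr m0 _] := lm.
have mC := lie_bracketC _ _ lm.
have mDl u v w : mu (u + v) w = mu u w + mu v w.
  by have [F FE] := linear_fun (ml w); rewrite -!FE raddfD.
have mDr u v w : mu w (u + v) = mu w u + mu w v.
  by have [F FE] := linear_fun (mr w); rewrite -!FE raddfD.
have mZl k u w : mu (k *: u) w = k *: mu u w.
  by have [F FE] := linear_fun (ml w); rewrite -!FE linearZ.
have mZr k u w : mu w (k *: u) = k *: mu w u.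
  by have [F FE] := linear_fun (mr w); rewrite -!FE linearZ.
rewrite {1}(coordE x) {1}(coordE y) !(mDl, mDr, mZl, mZr) !m0.
rewrite (mC f1 f2) (mC f1 f3) (mC f2 f3) mu12 mu13 mu23.
rewrite !oppr0 !scaler0 !(add0r, addr0) !scalerN -!scaleNr !scalerA -!scalerDl.
by congr (_ *: _); ring.
Qed.

(** In dimension 3 every 3-form is a multiple of the volume form; the factor in parentheses is the
    determinant of the coordinates. *)
Lemma adapted_form x y z : H x y z = h *
  (g x f1 * (g y f2 * g z f3 - g y f3 * g z f2)
   - g x f2 * (g y f1 * g z f3 - g y f3 * g z f1)
   + g x f3 * (g y f1 * g z f2 - g y f2 * g z f1)).
Proof.
have [h1 h2 h3 [h12 h13 h23]] := fH.
have H1 b c d k l m y' z' : H (b *: k + c *: l + d *: m) y' z'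
    = b * H k y' z' + c * H l y' z' + d * H m y' z'.
  by have [F FE] := scalar_fun (h1 y' z'); rewrite -!FE !raddfD /= !linearZ.
have H2 b c d k l m y' z' : H y' (b *: k + c *: l + d *: m) z'
    = b * H y' k z' + c * H y' l z' + d * H y' m z'.
  by have [F FE] := scalar_fun (h2 y' z'); rewrite -!FE !raddfD /= !linearZ.
have H3 b c d k l m y' z' : H y' z' (b *: k + c *: l + d *: m)
    = b * H y' z' k + c * H y' z' l + d * H y' z' m.
  by have [F FE] := scalar_fun (h3 y' z'); rewrite -!FE !raddfD /= !linearZ.
have A12 u v w : H v u w = - H u v w.
  (* Polarization of the alternating property; the zero summand only provides the three-term shape
     required by [H1] and [H2]. *)
  have := h12 (1 *: u + 1 *: v + 0 *: u) w.
  by rewrite H1 !H2 !h12 => ?; lra.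
have A23 u v w : H u w v = - H u v w.
  have := h23 (1 *: v + 1 *: w + 0 *: v) u.
  by rewrite H2 !H3 !h23 => ?; lra.
rewrite {1}(coordE x) {1}(coordE y) {1}(coordE z) H1 !H2 !H3.
(* The six surviving terms are sorted into [H f1 f2 f3] by adjacent transpositions. *)
rewrite !(h12, h13, h23) (A23 f1 f2 f3) (A12 f1 f2 f3) (A23 f2 f1 f3).
rewrite (A12 f1 f3 f2) (A23 f1 f2 f3) (A12 f2 f3 f1) (A23 f2 f1 f3).
rewrite (A12 f1 f2 f3) Hh.
ring.
Qed.

(** Koszul's formula [nablaE] gives the inner product with any vector, so the components along the
    adapted basis are available although [nabla] sums over [e]. *)
Let nabE x y :
  (g (nabla mu g e x y) f1 = a / 2 * (g x f3 * g y f2 + g x f2 * g y f3)) *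
  (g (nabla mu g e x y) f2 = - (a / 2) * (g x f3 * g y f1 + g x f1 * g y f3)) *
  (g (nabla mu g e x y) f3 = a / 2 * (g x f1 * g y f2 - g x f2 * g y f1)).
Proof.
by do !split; rewrite nablaE // !adapted_bracket !(innerZl ig)
  !adapted_gram ![g f3 _](inner_sym ig);
  field.
Qed.

(** The curvature operator is diagonal on the coordinate planes: the sectional curvature is -3a^2/4
    on (f1, f2) and a^2/4 on (f1, f3) and (f2, f3). *)
Let curvE x y z w : g (curvature mu g e x y z) w = a ^+ 2 / 4 *
  (3 * (g x f1 * g y f2 - g x f2 * g y f1)
     * (g z f1 * g w f2 - g z f2 * g w f1)
   + (g x f1 * g y f3 - g x f3 * g y f1) * (g z f3 * g w f1 - g z f1 * g w f3)
   + (g x f2 * g y f3 - g x f3 * g y f2) * (g z f3 * g w f2 - g z f2 * g w f3)).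
Proof.
rewrite (innerE _ w) /curvature !(innerBl ig) !nabE !adapted_bracket.
rewrite !(innerZl ig) !adapted_gram.
by field.
Qed.

Lemma adapted_ricci_form y z : ricci_form mu g e y z =
  a ^+ 2 / 2 * (g y f3 * g z f3 - g y f1 * g z f1 - g y f2 * g z f2).
Proof.
rewrite /ricci_form (onb_trace (b := fun u v => g (curvature mu g e u y z) v)
  ig oe of3) => [|v k s t|u k s t].
- by rewrite !big_cons big_nil !curvE !adapted_gram; field.
- by rewrite !curvE !(innerDl ig, innerZl ig); ring.
by rewrite !(inner_sym ig (curvature _ _ _ _ _ _)) (innerDl ig) (innerZl ig).
Qed.

(** Contracting the volume form with itself over ordered pairs gives 2g. The two sums over [e] are
    converted one at a time, the inner one first. *)
Lemma adapted_square_form x y :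
  square_form e H x y = 2 * h ^+ 2 * g x y.
Proof.
have E u : \sum_(v <- e) H x u v * H y u v =
  \sum_(v <- [:: f1; f2; f3]) H x u v * H y u v.
  apply: (onb_trace (b := fun v w => H x u v * H y u w) ig oe of3).
    by move=> w k s t; rewrite !adapted_form !(innerDl ig, innerZl ig); ring.
  by move=> w k s t; rewrite !(adapted_form y) !(innerDl ig, innerZl ig); ring.
rewrite /square_form; under eq_bigr do rewrite E.
rewrite (onb_trace
  (b := fun u w => \sum_(v <- [:: f1; f2; f3]) H x u v * H y w v)
  ig oe of3) => [|w k s t|w k s t].
- by rewrite !big_cons !big_nil !(adapted_form x) !(adapted_form y)
    !adapted_gram (innerE x y); ring.
- by rewrite !big_cons !big_nil !(adapted_form x)
    !(innerDl ig, innerZl ig); ring.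
by rewrite !big_cons !big_nil !(adapted_form y) !(innerDl ig, innerZl ig); ring.
Qed.

Lemma adapted_ricciB x : ricciB mu g e H x =
  ((a ^+ 2 - h ^+ 2) / 2 * g x f3) *: f3
  - ((a ^+ 2 + h ^+ 2) / 2) *: (g x f1 *: f1 + g x f2 *: f2).
Proof.
(* [sharp] is a sum over [e], so the right side is expanded along [e] too and coefficients are
   compared. *)
set rhs := RHS; rewrite (onb_expand rhs ig oe) /ricciB /ricci /sharp.
rewrite scaler_sumr -sumrB; apply: eq_bigr => u _.
rewrite scalerA -scalerBl; congr (_ *: _).
rewrite adapted_ricci_form adapted_square_form /rhs (innerBl ig) !(innerZl ig).
rewrite (innerDl ig) !(innerZl ig) ![g _ u](inner_sym ig) (inner_sym ig u x).
by rewrite (innerE x u); field.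
Qed.

(* The Heisenberg algebra is unimodular, so d2 vanishes into top degree and its
   adjoint is zero on 3-forms. *)
Lemma adapted_laplacian x y z : laplacian mu g e H x y z = 0.
Proof.
have cd0 u v : codifferential mu g e H u v = 0.
  rewrite /codifferential /form_dot3 big1 ?mulr0 // => x' _.
  rewrite big1 // => y' _; rewrite big1 // => z' _.
  rewrite /d2 /flat_wedge !adapted_bracket !(innerZr ig).
  by rewrite !(innerE _ x') !(innerE _ y') !(innerE _ z'); ring.
by rewrite /laplacian /d2 !cd0; ring.
Qed.

(** An endomorphism A acts on top-degree forms through [rho] as multiplication by -tr A, and here tr
    A = -(a^2 + h^2) + (a^2 - h^2)/2. *)
Lemma adapted_rho x y z : rho (ricciB mu g e H) H x y z
  = (a ^+ 2 + 3 * h ^+ 2) / 2 * H x y z.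
Proof.
rewrite /rho !adapted_ricciB !adapted_form.
by rewrite !(innerBl ig, innerZl ig, innerDl ig) !adapted_gram; field.
Qed.

End AdaptedBasis.

(** * The Heisenberg model in coordinates *)

Lemma row3P (T : Type) (x y : 'rV[T]_3) :
  x 0 0 = y 0 0 -> x 0 1 = y 0 1 -> x 0 2 = y 0 2 -> x = y.
Proof.
move=> x0 x1 x2; apply/rowP => k.
have : [|| k == 0, k == 1 | k == 2] by case: k => [[|[|[|k]]]].
by case/or3P => /eqP->.
Qed.

Section HeisenbergModel.
Context {R : realType}.
Implicit Types x y z : 'rV[R]_3.

Let sum_ord3 (F : 'I_3 -> R) : \sum_k F k = F 0 + F 1 + F 2.
Proof.
rewrite !big_ord_recl big_ord0 addr0 addrA.
by do ![congr (_ + _)]; congr F; apply: val_inj.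
Qed.

Lemma heis_formE x y z : heis_form x y z =
  x 0 0 * (y 0 1 * z 0 2 - y 0 2 * z 0 1)
  - x 0 1 * (y 0 0 * z 0 2 - y 0 2 * z 0 0)
  + x 0 2 * (y 0 0 * z 0 1 - y 0 1 * z 0 0).
Proof.
rewrite /heis_form (expand_det_row _ 0) sum_ord3 /cofactor.
rewrite !(expand_det_row _ 0) !big_ord_recl !big_ord0 /cofactor.
rewrite !det_mx11 !mxE /=.
(* Coordinates become functions of a natural number, so that ordinals with equal values but
   different proofs are identified. *)
have nE (v : 'rV[R]_3) : exists f : nat -> R, forall i, v 0 i = f i.
  by exists (fun n => v 0 (inord n)) => i; rewrite inord_val.
have [[Y YE] [Z ZE]] := (nE y, nE z).
rewrite !YE !ZE /= /bump /=.
rewrite -[(1 %% 3)%N]/1%N -[((1 + 1) %% 3)%N]/2%N /=.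
ring.
Qed.

Lemma heis_metric_basis x : (heis_metric x (heis_basis R 0) = x 0 0) *
  (heis_metric x (heis_basis R 1) = x 0 1) *
  (heis_metric x (heis_basis R 2) = x 0 2).
Proof.
by rewrite /heis_metric !sum_ord3 !mxE /= !(mulr0, mulr1, addr0, add0r).
Qed.

Lemma heis_inner_product : inner_product (@heis_metric R).
Proof.
split=> [z k x y|x y|x].
- by rewrite /heis_metric !sum_ord3 !mxE; ring.
- by rewrite /heis_metric !sum_ord3; ring.
move=> x0; rewrite lt_def /heis_metric sumr_ge0 ?andbT => [|k _]; last first.
  by rewrite -expr2 sqr_ge0.
apply: contra x0; rewrite psumr_eq0 => [/allP x0|k _]; last first.
  by rewrite -expr2 sqr_ge0.
apply/eqP/rowP => k; rewrite mxE; have := x0 k (mem_index_enum _).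
by rewrite mulf_eq0 orbb => /eqP.
Qed.

Lemma heis_orthonormal : orthonormal_basis (@heis_metric R)
  [:: heis_basis R 0; heis_basis R 1; heis_basis R 2].
Proof.
have hb (i j : 'I_3) : (heis_basis R i == heis_basis R j) = (i == j).
  apply/eqP/eqP => [/rowP/(_ i)|->] //.
  by rewrite !mxE !eqxx /=; case: eqP => // _ /eqP; rewrite oner_eq0.
apply: orthonormal_basisP; last by rewrite dim_matrix.
  exact: heis_inner_product.
split=> [|u v]; first by rewrite /= !inE !hb.
rewrite !inE => /or3P[]/eqP-> /or3P[]/eqP->;
  by rewrite heis_metric_basis hb !mxE.
Qed.

Lemma heis_lie_bracket : lie_bracket (@heis_bracket R).
Proof.
split=> [y k x z|x k y z|x|x y z]; rewrite /heis_bracket.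
- by rewrite scalerA -scalerDl !mxE; congr (_ *: _); ring.
- by rewrite scalerA -scalerDl !mxE; congr (_ *: _); ring.
- by rewrite mulrC subrr scale0r.
rewrite !mxE /= -!scalerDl -[RHS](scale0r (heis_basis R 2)).
by congr (_ *: _); ring.
Qed.

Lemma heis_nilpotent : nilpotent_bracket (@heis_bracket R).
Proof.
(* The first derived term lies in the line of [heis_basis R 2], which is central, so the next term
   is zero. *)
exists 2; apply/eqP; rewrite -subv0; apply/span_subvP => w /allpairsP[[x y]] /=.
case=> _ /vbasis_mem y1 ->; rewrite memv0.
have: (y \in <[heis_basis R 2]>)%VS.
  apply: subvP y1; apply/span_subvP => u /allpairsP[[s t]] /= [_ _ ->].
  by rewrite memvZ // memv_line.
by case/vlineP=> k ->; rewrite /heis_bracket !mxE /= !mulr0 subrr scale0r.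
Qed.

Lemma heis_three_form : three_form (@heis_form R).
Proof.
split=> [y z k s t|x z k s t|x y k s t|].
1-3: by rewrite !heis_formE !mxE; ring.
by split=> x y; rewrite heis_formE; ring.
Qed.

(** A 4-form on a 3-dimensional space vanishes, which here is a polynomial identity in the
    coordinates. *)
Lemma heis_closed : Defs.closed (@heis_bracket R) (@heis_form R).
Proof.
by move=> x y z w; rewrite /d3 !heis_formE /heis_bracket !mxE /=; ring.
Qed.

Lemma heis_derivationE x k :
  heis_derivation R x 0 k = (if k == 2 then 2 else 1) * x 0 k.
Proof.
rewrite /heis_derivation lfunE /= mul_mx_diag !mxE mulrC; congr (_ * _).
by case: k => [[|[|[|k]]]].
Qed.

(** The bracket of two vectors of weight 1 has weight 2. *)
Lemma heis_derivation_derivation :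
  derivation (@heis_bracket R) (heis_derivation R).
Proof.
move=> x y; apply/rowP => k.
rewrite heis_derivationE [RHS]mxE /heis_bracket !mxE !heis_derivationE /=.
by case: (k == 2); rewrite /= ?(mulr0, addr0) //; ring.
Qed.

Lemma heis_form_basis :
  heis_form (heis_basis R 0) (heis_basis R 1) (heis_basis R 2) = 1.
Proof. by rewrite heis_formE !mxE /=; ring. Qed.

Lemma heis_nilsoliton :
  nilsoliton_with (@heis_bracket R) (@heis_metric R) (@heis_form R)
    [:: heis_basis R 0; heis_basis R 1; heis_basis R 2] (- 2)
    (heis_derivation R).
Proof.
have b12 : heis_bracket (heis_basis R 0) (heis_basis R 1) = 1 *: heis_basis R 2.
  by rewrite /heis_bracket !mxE /= mulr1 mulr0 subr0.
have b13 : heis_bracket (heis_basis R 0) (heis_basis R 2) = 0.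
  by rewrite /heis_bracket !mxE /= !mulr0 subr0 scale0r.
have b23 : heis_bracket (heis_basis R 1) (heis_basis R 2) = 0.
  by rewrite /heis_bracket !mxE /= !mulr0 subr0 scale0r.
have lb := heis_lie_bracket; have ip := heis_inner_product.
have fH := heis_three_form; have on := heis_orthonormal.
split.
- split=> //; [exact: heis_nilpotent|exact: heis_closed].
- exact: heis_orthonormal.
- exact: heis_derivation_derivation.
(* For a = h = 1 the eigenvalues of [ricciB] are -1, -1, 0, that is, -2 plus 1, 1, 2. *)
- move=> x; rewrite (adapted_ricciB lb ip fH on on b12 b13 b23 heis_form_basis).
  by apply: row3P;
    rewrite !heis_metric_basis [RHS]mxE heis_derivationE !mxE /=; field.
move=> x y z.
rewrite (adapted_laplacian _ _ lb ip on b12 b13 b23).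
(* The factor (1 + 3)/2 of [rho] cancels lambda = -2. *)
by rewrite (adapted_rho lb ip fH on on b12 b13 b23 heis_form_basis); field.
Qed.

End HeisenbergModel.

(** * The soliton equations in an adapted basis *)

Section Classification.
Context {R : realType} {V : vectType R}.
Variables (mu : V -> V -> V) (g : V -> V -> R) (H : V -> V -> V -> R).
Variables (f1 f2 f3 : V) (a h : R).
Hypotheses (lm : lie_bracket mu) (ig : inner_product g) (fH : three_form H).
Hypotheses (oF : orthonormal_basis g [:: f1; f2; f3]).
Hypotheses (mu12 : mu f1 f2 = a *: f3).
Hypotheses (mu13 : mu f1 f3 = 0) (mu23 : mu f2 f3 = 0).
Hypothesis Hh : H f1 f2 f3 = h.

Lemma adapted_nilsoliton e lambda D :
  nilsoliton_with mu g H e lambda D -> a != 0 -> h != 0 -> a ^+ 2 = h ^+ 2.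
Proof.
move=> [_ oe dD ricE lapE] a0 h0.
have gf := adapted_gram oF.
have := lapE f1 f2 f3.
rewrite (adapted_laplacian _ _ lm ig oF mu12 mu13 mu23).
rewrite (adapted_rho lm ig fH oe oF mu12 mu13 mu23 Hh) Hh -mulrDl.
(* Dividing by h leaves lambda = -(a^2 + 3 h^2)/2. *)
move=> /esym/eqP; rewrite mulf_eq0 (negPf h0) orbF => /eqP lamE.
have Df x : D x = ricciB mu g e H x - lambda *: x by rewrite ricE addrC addKr.
(* [D] is diagonal in the adapted basis; the f3-component of the derivation identity at (f1, f2)
   says that, since a is nonzero, its eigenvalue on f3 is the sum of those on f1 and f2. *)
have := congr1 (g ^~ f3) (dD f1 f2).
rewrite mu12 linearZ /= !Df !(adapted_ricciB lm ig fH oe oF mu12 mu13 mu23 Hh).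
rewrite !gf !(adapted_bracket lm ig oF mu12 mu13 mu23).
rewrite !(innerDl ig, innerNl ig, innerZl ig) !gf => E.
have /(mulfI a0) {}E : a * ((a ^+ 2 - h ^+ 2) / 2 - lambda)
  = a * (2 * (- ((a ^+ 2 + h ^+ 2) / 2) - lambda)) by lra.
by lra.
Qed.

(** Scaling coordinates by a normalizes the bracket constant a to 1. It multiplies the metric by a^2
    and the determinant by a^3, and a^3 = (h / a) a^2 h because a^2 = h^2. *)
Lemma adapted_equivalent : a != 0 -> a ^+ 2 = h ^+ 2 ->
  equivalent_triples mu g H (@heis_bracket R) (@heis_metric R) (@heis_form R).
Proof.
move=> a0 ah.
pose c x : 'rV[R]_3 := a *: \row_k nth 0 [:: g x f1; g x f2; g x f3] k.
have cE x : (c x 0 0 = a * g x f1) * (c x 0 1 = a * g x f2) *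
    (c x 0 2 = a * g x f3) by rewrite !mxE.
have cl : linear c.
  move=> k x y; apply: row3P;
    by rewrite !mxE /= (innerDl ig) (innerZl ig); ring.
have [F Fc] := linear_fun cl.
have FE x : linfun F x = c x by rewrite lfunE.
have gf := adapted_gram oF.
exists (linfun F), (a ^+ 2), (h / a); split.
- split.
    pose d (y : 'rV[R]_3) := a^-1 *: (y 0 0 *: f1 + y 0 1 *: f2 + y 0 2 *: f3).
    exists d => [x|y]; rewrite /d.
      rewrite FE !cE -!(scalerA a) -!scalerDr scalerA mulVf // scale1r.
      by rewrite [RHS](onb_expand x ig oF) !big_cons big_nil addr0 addrA.
    by rewrite FE; apply: row3P; rewrite cE !(innerZl ig, innerDl ig) !gf
      !(mulr0, mulr1, addr0, add0r) mulVKf.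
  move=> x y; rewrite !FE (adapted_bracket lm ig oF mu12 mu13 mu23).
  by apply: row3P; rewrite cE (innerZl ig) !gf /heis_bracket !cE !mxE /=; ring.
- by rewrite exprn_even_gt0.
- move/eqP: ah; rewrite eq_sym eqf_sqr => /orP[]/eqP->.
    by left; rewrite divff.
  by right; rewrite mulNr divff.
- move=> x y; rewrite !FE /heis_metric !big_ord_recl big_ord0 !mxE /=.
  rewrite (onb_parseval ig x y oF) !big_cons big_nil; ring.
move=> x y z; rewrite !FE heis_formE !cE.
rewrite (adapted_form ig fH oF Hh x y z); set d := (X in _ = _ * (h * X)).
have -> : h / a * a ^+ 2 * (h * d) = a * h ^+ 2 * d by field.
by rewrite -ah /d; ring.
Qed.

End Classification.

(** * Reduction of an arbitrary Heisenberg triple to an adapted basis *)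

Lemma heis_classification (R : realType) (V : vectType R) (mu : V -> V -> V)
    (g : V -> V -> R) (H : V -> V -> V -> R) :
  lie_isomorphic mu (@heis_bracket R) -> generalized_nilsoliton mu g H ->
  non_classical H ->
  equivalent_triples mu g H (@heis_bracket R) (@heis_metric R) (@heis_form R).
Proof.
move=> [psi [[inv invK psiK] psiM]] [e [lambda [D sol]]] ncH.
have [[lm _ ig fH _] _ _ _ _] := sol.
(* [v] spans the centre, which is also the derived algebra; normalized, it becomes [f3]. *)
pose v := inv (heis_basis R 2).
have pv : psi v = heis_basis R 2 by rewrite /v psiK.
have v0 : v != 0.
  apply: contra_eq_neq pv => ->; rewrite linear0.
  by apply/eqP => /rowP/(_ 2)/eqP; rewrite !mxE eq_sym oner_eq0.
have dV : dim V = 3.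
  have k0 : lker psi == 0%VS by apply/lker0P/(can_inj invK).
  have /limg_dim_eq : ({:V} :&: lker psi = 0)%VS by rewrite (eqP k0) capv0.
  rewrite dimvf => <-; have -> : limg psi = {:'rV[R]_3}%VS.
    by apply/vspaceP => y; rewrite memvf -(psiK y) memv_img ?memvf.
  by rewrite dimvf dim_matrix.
have muE x y : mu x y = (psi x 0 0 * psi y 0 1 - psi x 0 1 * psi y 0 0) *: v.
  by apply: (can_inj invK); rewrite psiM linearZ /= pv.
have [f1 [f2 oF]] := onb_adapted ig v0 dV.
set f3 := (_ *: v) in oF.
have muv x : mu x f3 = 0.
  by rewrite muE /f3 linearZ /= pv !mxE /= !mulr0 subrr scale0r.
have [a mu12] : exists a, mu f1 f2 = a *: f3.
  rewrite muE /f3; set r := _^-1; have r0 : r != 0.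
    rewrite invr_eq0 sqrtr_eq0 -ltNge; have [_ _] := ig; exact.
  (* Dividing by [r] compensates the normalization of [f3]. *)
  by eexists (_ / r); rewrite scalerA divfK.
have h0 : H f1 f2 f3 != 0.
  case: ncH => x [y [z]]; apply: contra_neq => h0.
  by rewrite (adapted_form ig fH oF h0) mul0r.
(* If a were 0 the bracket would vanish, but the preimages of the first two model vectors have
   bracket [v], which is nonzero. *)
have a0 : a != 0.
  have : heis_bracket (psi (inv (heis_basis R 0))) (psi (inv (heis_basis R 1)))
      != 0.
    rewrite !psiK /heis_bracket !mxE /= mulr1 mulr0 subr0 scale1r -pv.
    by rewrite -(inj_eq (can_inj invK)) linear0 in v0.
  rewrite -psiM; apply: contra_neq => a0.
  by rewrite (adapted_bracket lm ig oF mu12) // a0 mul0r scale0r linear0.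
have ah := adapted_nilsoliton lm ig fH oF mu12 (muv _) (muv _) erefl sol a0 h0.
exact: (adapted_equivalent lm ig fH oF mu12 (muv _) (muv _) erefl a0 ah).
Qed.

Theorem proposition10p1 (R : realType) :
  (nilsoliton_with (@heis_bracket R) (@heis_metric R) (@heis_form R)
     [:: heis_basis R 0; heis_basis R 1; heis_basis R 2]
     (- 2) (heis_derivation R) /\
   non_classical (@heis_form R)) /\
  (forall (V : vectType R) (mu : V -> V -> V) (g : V -> V -> R)
      (H : V -> V -> V -> R),
    lie_isomorphic mu (@heis_bracket R) ->
    generalized_nilsoliton mu g H ->
    non_classical H ->
    equivalent_triples mu g H
      (@heis_bracket R) (@heis_metric R) (@heis_form R)).
Proof.
split; last exact: heis_classification.
split; first exact: heis_nilsoliton.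
exists (heis_basis R 0), (heis_basis R 1), (heis_basis R 2).
by rewrite heis_form_basis oner_neq0.
Qed.
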